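(* Let $p$ be a prime and $F=GF(p)$. Let $A\in GL(2,p)$ be such that $FI\oplus FA$ is an anisotropic plane in $M(2,p)$. Then the loop $Q=Q(A)$ defined on $F\times(F\times F)$ by $$(a,x)\cdot(b,y)=(a+b,\ x(I+bA)+y(I-aA))$$ is an automorphic loop of order $p^3$ and exponent $p$ with $N_\mu(Q)=\{(0,x): x\in F\times F\}\cong F\times F$ and $N_\lambda(Q)=N_\rho(Q)=1$. In particular, $N(Q)=Z(Q)=1$ and so $Q$ is not centrally nilpotent. In addition, if $p=2$ then $C(Q)=Q$, while if $p>2$ then $C(Q)=1$.
   Context: $M(2,p)$ is the space of $2\times2$ matrices over $F=GF(p)$, $I$ the identity matrix. A subspace $W\le M(2,p)$ is anisotropic (with respect to the quadratic form $\det$) if $\det(X)\neq0$ for every $0\ne X\in W$; an anisotropic plane is an anisotropic subspace of dimension two. Elements of $F\times F$ are row vectors, on which matrices act by right multiplication. A loop is a set $Q$ with a binary operation such that all left translations $L_x:y\mapsto xy$ and right translations $R_x:y\mapsto yx$ are bijections, with a two-sided identity element $1$. The inner mapping group $\mathrm{Inn}\,Q$ is the stabilizer of $1$ in the permutation group generated by all $L_x,R_x$. $Q$ is automorphic if every element of $\mathrm{Inn}\,Q$ is an automorphism of $Q$; automorphic loops are power-associative, so powers are well defined. The groupoid $Q(A)$ is a loop with identity element $(0,0)$. For a loop $Q$: $N_\lambda(Q)=\{a: ax\cdot y=a\cdot xy\ \forall x,y\}$, $N_\mu(Q)=\{a: xa\cdot y=x\cdot ay\ \forall x,y\}$, $N_\rho(Q)=\{a: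 xy\cdot a=x\cdot ya\ \forall x,y\}$, $N(Q)=N_\lambda(Q)\cap N_\mu(Q)\cap N_\rho(Q)$, $C(Q)=\{a: ax=xa\ \forall x\}$, $Z(Q)=N(Q)\cap C(Q)$; ''$=1$'' means equal to the trivial subloop consisting of the identity. The isomorphism $N_\mu(Q)\cong F\times F$ is with the additive group of $F\times F$. Put $Z_0(Q)=\{1\}$ and let $Z_{i+1}(Q)$ be the preimage of $Z(Q/Z_i(Q))$ under $Q\to Q/Z_i(Q)$; $Q$ is centrally nilpotent if $Z_n(Q)=Q$ for some $n$. *)

(* Defs.v *)
From HB Require Import structures.
From mathcomp Require Import all_boot all_order all_fingroup all_algebra.

Set Implicit Arguments.
Unset Strict Implicit.
Unset Printing Implicit Defensive.

Import GRing.Theory.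

(* The library's magma hierarchy has no join with finite types below the finite
   star-monoids, which are associative. *)
HB.mixin Record hasLoopOps Q := { lmul : Q -> Q -> Q; lone : Q }.

#[short(type="finPointedMagmaType")]
HB.structure Definition FinPointedMagma := {Q of hasLoopOps Q & Finite Q}.

Declare Scope loop_scope.
Delimit Scope loop_scope with L.
Notation "x * y" := (lmul x y) : loop_scope.
Notation "1" := lone : loop_scope.

Section Loops.
Local Open Scope loop_scope.
Variable Q : finPointedMagmaType.
Implicit Types (x y : Q) (N : {set Q}).

Definition is_loop : Prop :=
  [/\ forall x, 1 * x = x,
      forall x, x * 1 = x,
      forall x, bijective (fun y => x * y)
    & forall x, bijective (fun y => y * x)].

Definition left_translations : {set {perm Q}} :=
  [set s : {perm Q} | [exists x, forall y, s y == x * y]].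

Definition right_translations : {set {perm Q}} :=
  [set s : {perm Q} | [exists x, forall y, s y == y * x]].

Definition multiplication_group : {group {perm Q}} :=
  <<left_translations :|: right_translations>>%G.

Definition inner_mapping_group : {set {perm Q}} :=
  'C_multiplication_group[(lone : Q) | 'P]%g.

Definition is_automorphic_loop : Prop :=
  is_loop /\
  forall s : {perm Q}, s \in inner_mapping_group -> {morph s : x y / x * y}.

(* Right-nested powers x * (x * ...); in a power-associative loop the bracketing
   is immaterial. *)
Definition loop_exp x (n : nat) : Q := iter n (lmul x) 1.

Definition has_exponent (n : nat) : Prop :=
  [/\ (0 < n)%N,
      forall x, loop_exp x n = 1
    & forall m, (0 < m)%N -> (forall x, loop_exp x m = 1) -> (n <= m)%N].

Definition left_nucleus : {set Q} :=
  [set a : Q | [forall x, forall y, (a * x) * y == a * (x * y)]].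

Definition middle_nucleus : {set Q} :=
  [set a : Q | [forall x, forall y, (x * a) * y == x * (a * y)]].

Definition right_nucleus : {set Q} :=
  [set a : Q | [forall x, forall y, (x * y) * a == x * (y * a)]].

Definition nucleus : {set Q} := left_nucleus :&: middle_nucleus :&: right_nucleus.

Definition commutant : {set Q} := [set a : Q | [forall x, a * x == x * a]].

Definition loop_center : {set Q} := nucleus :&: commutant.

Definition loop_coset N x : {set Q} := [set x * n | n in N].

Definition loop_quotient N : Type :=
  {B : {set Q} | B \in codom (loop_coset N)}.

HB.instance Definition _ N := Finite.on (loop_quotient N).

Definition quotient_proj N x : loop_quotient N :=
  exist _ (loop_coset N x) (codom_f (loop_coset N) x).

Definition quotient_repr N (B : loop_quotient N) : Q := iinv (valP B).

(* The product of two cosets is computed on representatives. This is the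
   quotient loop when N is a normal subloop (see quotient_projM below), and the
   terms of the upper central series of a loop are normal subloops. *)
Definition quotient_mul N (B C : loop_quotient N) : loop_quotient N :=
  quotient_proj N (quotient_repr B * quotient_repr C).

HB.instance Definition _ N :=
  hasLoopOps.Build (loop_quotient N) (@quotient_mul N) (quotient_proj N 1).

Lemma quotient_projM N :
    (forall x, loop_coset N x = [set n * x | n in N]) ->
    (forall x y, [set x * z | z in loop_coset N y] = loop_coset N (x * y)) ->
    (forall x y, [set z * y | z in [set n * x | n in N]] =
                 [set n * (x * y) | n in N]) ->
  {morph quotient_proj N : x y / x * y}.
Proof.
move=> NC NL NR x y; apply: val_inj => /=.
have reprK z : loop_coset N (quotient_repr (quotient_proj N z)) = loop_coset N z.
  exact: f_iinv.
rewrite -NL -[in RHS]NL reprK !NL NC -NR -NC -[in LHS]reprK NC NR -NC.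
by [].
Qed.

End Loops.

Arguments is_loop : clear implicits.
Arguments is_automorphic_loop : clear implicits.
Arguments has_exponent : clear implicits.
Arguments left_nucleus : clear implicits.
Arguments middle_nucleus : clear implicits.
Arguments right_nucleus : clear implicits.
Arguments nucleus : clear implicits.
Arguments commutant : clear implicits.
Arguments loop_center : clear implicits.

Fixpoint upper_central (Q : finPointedMagmaType) (i : nat) : {set Q} :=
  if i is j.+1 then
    quotient_proj (upper_central Q j) @^-1:
      loop_center (loop_quotient (upper_central Q j))
  else [set 1%L].

Definition centrally_nilpotent (Q : finPointedMagmaType) : Prop :=
  exists n : nat, upper_central Q n = [set: Q].

Section Anisotropic.
Local Open Scope ring_scope.
Variables (F : fieldType) (n : nat).

Definition anisotropic (W : {vspace 'M[F]_n}) : Prop :=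
  forall X : 'M[F]_n, X \in W -> X != 0 -> \det X != 0.

Definition anisotropic_plane (W : {vspace 'M[F]_n}) : Prop :=
  anisotropic W /\ \dim W = 2.

End Anisotropic.

Section LoopQ.
Local Open Scope ring_scope.

Definition loopQ (p : nat) (A : 'M['F_p]_2) : Type := ('F_p * 'rV['F_p]_2)%type.

Variables (p : nat) (A : 'M['F_p]_2).

Definition loopQ_mul (u v : loopQ A) : loopQ A :=
  (u.1 + v.1, u.2 *m (1%:M + v.1 *: A) + v.2 *m (1%:M - u.1 *: A)).

HB.instance Definition _ := Finite.on (loopQ A).
HB.instance Definition _ := hasLoopOps.Build (loopQ A) loopQ_mul ((0, 0) : loopQ A).

End LoopQ.

Arguments loopQ {p} A.

(* Main.v *)
(**
Write M b = I + b A. Every left and every right translation of Q(A) has the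
shape (b, y) |-> (b + c, y U + w + b z) with U commuting with A, and maps of
this shape are closed under composition. Such a map fixes (0, 0) only if c = 0
and w = 0, and then it is an automorphism: the terms a b z A and - a b z A
coming from z M b and z M (- a) cancel. The nuclei and the commutant are read
off the associators and commutators, which are multiples of vectors x A^2 and
x A. Finally, a loop with trivial center has a constant upper central series.
*)
Require Import Defs.
From mathcomp Require Import all_boot all_order all_fingroup all_algebra.
From mathcomp Require Import ring.

Set Implicit Arguments.
Unset Strict Implicit.
Unset Printing Implicit Defensive.

Import GRing.Theory.

(** * The upper central series over a trivial center *)

Section Magmas.
Local Open Scope loop_scope.

(** Centrality is a conjunction of universally quantified equations, and an isomorphism transports
    both quantifiers and equations. *)
Lemma preim_loop_center (Q Q' : finPointedMagmaType) (f : Q -> Q') :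
    bijective f -> {morph f : x y / x * y} ->
  f @^-1: loop_center Q' = loop_center Q.
Proof.
move=> f_bij fM; have f_inj := bij_inj f_bij.
have [g _ gK] := f_bij.
have all1E (P : pred Q') : [forall y, P y] = [forall x, P (f x)].
  by apply/forallP/forallP => H y; [exact: H | rewrite -[y]gK].
have eqM := inj_eq f_inj.
apply/setP => a; rewrite !inE !all1E.
by congr [&& [&& _ & _] && _ & _]; apply: eq_forallb => x;
  rewrite ?all1E -?fM ?eqM //; apply: eq_forallb => y; rewrite -!fM eqM.
Qed.

(** The cosets of [[set 1]] are singletons, so the projection modulo the trivial subloop is an
    isomorphism and each new term is again the center. *)
Lemma upper_central_trivial (Q : finPointedMagmaType) (i : nat) :
    is_loop Q -> loop_center Q = [set 1] ->
  upper_central Q i = [set 1].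
Proof.
move=> [mul1x mulx1 _ _] Z1; elim: i => //= i ->; rewrite -[RHS]Z1.
have cosetE (x : Q) : loop_coset [set 1] x = [set x].
  by rewrite /loop_coset imset_set1 mulx1.
apply: (@preim_loop_center Q (loop_quotient [set 1])).
  exists (@quotient_repr Q [set 1]) => [x|B].
    by apply: set1_inj; rewrite -cosetE -[RHS]cosetE; apply: f_iinv.
  by apply: val_inj; apply: f_iinv.
by apply: quotient_projM => x *; rewrite ?cosetE !imset_set1 ?mul1x.
Qed.

End Magmas.

(** * Bijectivity of the translations of Q(A) *)

Section AnisotropicLoop.
Local Open Scope ring_scope.
Variables (p : nat) (A : 'M['F_p]_2).
Local Notation F := 'F_p.
Local Notation V := 'rV['F_p]_2.
Local Notation Q := (loopQ A).

(** The matrix lies in the plane, and if it were zero, then I would lie in the intersection of FI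
    and FA, which is zero. *)
Lemma anisotropic_unitmx (b : F) :
    directv (<[1%:M : 'M[F]_2]> + <[A]>)%VS ->
    anisotropic (<[1%:M : 'M[F]_2]> + <[A]>)%VS ->
  1%:M + b *: A \in unitmx.
Proof.
move=> dIA anisoIA; rewrite unitmxE unitfE; apply: anisoIA.
  by rewrite memv_add ?memvZ ?memv_line.
apply/eqP => /eqP; rewrite addr_eq0 => /eqP I_bA.
have := oner_neq0 'M[F]_2; rewrite -memv0 => /negP[].
rewrite -(directv_addP dIA) memv_cap memv_line.
by rewrite [1]I_bA -scaleNr memvZ ?memv_line.
Qed.

Lemma loopQ_mulE (a b : F) (x y : V) :
  lmul ((a, x) : Q) (b, y) =
    (a + b, x + b *: (x *m A) + (y - a *: (y *m A))).
Proof.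
congr pair; rewrite /= mulmxDr mulmxBr !mulmx1.
by rewrite -!scalemxAr.
Qed.

Lemma loopQ_is_loop :
    (forall b : F, 1%:M + b *: A \in unitmx) ->
  is_loop Q.
Proof.
move=> M_unit.
have N_unit a : 1%:M - a *: A \in unitmx by rewrite -scaleNr.
have id1 (x : V) : x + 0 *: (x *m A) = x by rewrite scale0r addr0.
have id2 (x : V) : x - 0 *: (x *m A) = x by rewrite scale0r subr0.
split=> [[a x]|[a x]|[a x]|[a x]].
- by rewrite loopQ_mulE id2 mul0mx scaler0 !add0r.
- by rewrite loopQ_mulE id1 mul0mx scaler0 subr0 !addr0.
(* On a finite set injectivity suffices: the first coordinates give b = b', then I - aA is cancelled
   in the second. *)
- apply: injF_bij => -[b y] [b' y'] /eqP.
  rewrite xpair_eqE => /andP[/eqP/addrI/= <- /eqP/addrI/=].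
  by move/(can_inj (mulmxK (N_unit _))) ->.
- apply: injF_bij => -[b y] [b' y'] /eqP.
  rewrite xpair_eqE => /andP[/eqP/addIr/= <- /eqP/addIr/=].
  by move/(can_inj (mulmxK (M_unit _))) ->.
Qed.

(** * Inner mappings as affine permutations *)

Definition affine_perm : {set {perm Q}} :=
  [set s : {perm Q} | [exists c : F, exists U : 'M[F]_2, exists w : V,
    exists z : V, (U *m A == A *m U) &&
      [forall b : F, forall y : V,
         s ((b, y) : Q) == (b + c, y *m U + w + b *: z)]]].

Lemma affine_permP (s : {perm Q}) :
  reflect (exists (c : F) (U : 'M[F]_2) (w z : V), U *m A = A *m U /\
             forall b y, s ((b, y) : Q) = (b + c, y *m U + w + b *: z))
          (s \in affine_perm).
Proof.
rewrite inE; apply: (iffP existsP).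
  case=> c /existsP[U /existsP[w /existsP[z /andP[/eqP UA /forallP sE]]]].
  by exists c, U, w, z; split=> // b y; apply/eqP; move: y; apply/forallP.
case=> c [U [w [z [UA sE]]]]; exists c.
apply/existsP; exists U; apply/existsP; exists w; apply/existsP; exists z.
by rewrite UA eqxx; apply/forallP => b; apply/forallP => y; rewrite sE.
Qed.

Lemma affine_perm_group_set : group_set affine_perm.
Proof.
apply/group_setP; split=> [|s t /affine_permP[c [U [w [z [UA sE]]]]]].
  apply/affine_permP; exists 0, 1%:M, 0, 0; rewrite mulmx1 mul1mx.
  by split=> // b y; rewrite perm1 scaler0 mulmx1 !addr0.
case/affine_permP=> c' [U' [w' [z' [UA' tE]]]]; apply/affine_permP.
(* [t] acts after [s] and meets the first coordinate b + c, so (b + c) z' splits into the constant c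
   z' and the slope z'. *)
exists (c + c'), (U *m U'), (w *m U' + w' + c *: z'), (z *m U' + z').
split=> [|b y]; first by rewrite -mulmxA UA' !mulmxA UA.
rewrite permM sE tE addrA !mulmxDl -scalemxAl mulmxA; congr pair.
move: (y *m U *m U') (w *m U') (z *m U') => y1 w1 z1.
by apply/rowP => i; rewrite !mxE; ring.
Qed.

Lemma multiplication_group_affine :
  multiplication_group Q \subset affine_perm.
Proof.
rewrite -[affine_perm]/(gval (group affine_perm_group_set)) gen_subG.
have comm (a : F) : (1%:M + a *: A) *m A = A *m (1%:M + a *: A).
  by rewrite mulmxDl mulmxDr mul1mx mulmx1 -scalemxAl -scalemxAr.
apply/subsetP => s /setUP[]; rewrite inE => /existsP[[a x] /forallP sE];
  apply/affine_permP.
  (* Expanding x(I + bA) = x + b xA gives w = x and z = xA; right translations reverse the sign of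
     A. *)
  exists a, (1%:M + (- a) *: A), x, (x *m A); split=> // b y.
  rewrite (eqP (sE _)) loopQ_mulE addrC scaleNr mulmxBr mulmx1 -scalemxAr.
  by congr pair; rewrite addrC addrA.
exists a, (1%:M + a *: A), x, (- (x *m A)); split=> // b y.
by rewrite (eqP (sE _)) loopQ_mulE mulmxDr mulmx1 -scalemxAr scalerN addrA.
Qed.

Lemma loopQ_inner_morph (s : {perm Q}) :
  s \in inner_mapping_group Q -> {morph s : x y / lmul x y}.
Proof.
rewrite inE => /andP[/(subsetP multiplication_group_affine)].
case/affine_permP=> c [U [w [z [UA sE]]]] /astab1P.
rewrite /= apermE sE mul0mx scale0r addr0 !add0r => /eqP.
rewrite xpair_eqE => /andP[/eqP c0 /eqP w0].
move=> [a x] [b y]; rewrite loopQ_mulE !sE loopQ_mulE c0 w0 !addr0.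
(* Since A commutes with U, both sides are combinations of xU, yU, xUA, yUA, z and zA. *)
congr pair; rewrite !(mulmxDl, mulmxBl, mulNmx) -!scalemxAl -!mulmxA -UA !mulmxA.
move: (x *m U) (y *m U) (x *m U *m A) (y *m U *m A) (z *m A) => x1 y1 x2 y2 z2.
by apply/rowP => i; rewrite !mxE; ring.
Qed.

(** In (a, x)(na, nx) the terms na xA and - a (nx)A cancel, so powers are the multiples in the
    additive group. *)
Lemma loopQ_expE (a : F) (x : V) (n : nat) :
  loop_exp ((a, x) : Q) n = (a *+ n, x *+ n).
Proof.
rewrite /loop_exp; elim: n => //= n ->; rewrite loopQ_mulE !mulrS; congr pair.
rewrite -[x *+ n]scaler_nat -[a *+ n]mulr_natr -scalemxAl; move: (x *m A) => x1.
by apply/rowP => i; rewrite !mxE; ring.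
Qed.

Lemma loopQ_has_exponent : prime p -> has_exponent Q p.
Proof.
move=> p_pr; have pF := pchar_Fp p_pr; split=> [|[a x]|m m_gt0 exp_m].
- exact: prime_gt0.
- by rewrite loopQ_expE -mulr_natr -scaler_nat (pcharf0 pF) mulr0 scale0r.
(* The m-th power of (1, 0) is trivial only if p divides m. *)
have /(congr1 fst)/= /eqP := exp_m ((1, 0) : Q).
by rewrite loopQ_expE -(dvdn_pcharf pF) => /dvdn_leq ->.
Qed.

(** The terms linear in A cancel, and y is multiplied on both sides by the commuting factors I - aA
    and I + cA. The difference left is bc xA^2 - ab zA^2. *)
Lemma loopQ_associator (a b c : F) (x y z : V) :
  (lmul (lmul ((a, x) : Q) (b, y)) (c, z)
     == lmul ((a, x) : Q) (lmul ((b, y) : Q) (c, z))) =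
  ((b * c) *: (x *m A *m A) == (a * b) *: (z *m A *m A)).
Proof.
rewrite !loopQ_mulE xpair_eqE addrA eqxx /= -subr_eq0 -[RHS]subr_eq0.
congr (_ == 0); rewrite !(mulmxDl, mulmxBl, mulNmx) -!scalemxAl.
move: (x *m A *m A) (y *m A *m A) (z *m A *m A) => x2 y2 z2.
move: (x *m A) (y *m A) (z *m A) => x1 y1 z1.
by apply/rowP => i; rewrite !mxE; ring.
Qed.

(** The two products differ by 2b xA - 2a yA; the factor 2 separates p = 2 from odd p. *)
Lemma loopQ_commutator (a b : F) (x y : V) :
  (lmul ((a, x) : Q) (b, y) == lmul ((b, y) : Q) (a, x)) =
  ((b *+ 2) *: (x *m A) == (a *+ 2) *: (y *m A)).
Proof.
rewrite !loopQ_mulE xpair_eqE addrC eqxx /= -subr_eq0 -[RHS]subr_eq0.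
congr (_ == 0); move: (x *m A) (y *m A) => x1 y1.
by apply/rowP => i; rewrite !mxE; ring.
Qed.

(** * Nuclei, center and commutant *)

Section Nuclei.
Hypothesis A_unit : A \in unitmx.

Let mulA_eq0 (x : V) : (x *m A == 0) = (x == 0).
Proof. by rewrite -[0 in LHS](mul0mx _ A) (inj_eq (can_inj (mulmxK A_unit))). Qed.

(** A nonzero vector, used to show that first coordinates vanish. *)
Let v : V := const_mx 1.

Let v_neq0 : v != 0.
Proof. by apply/eqP => /rowP/(_ 0)/eqP; rewrite !mxE oner_eq0. Qed.

Lemma loopQ_middle_nucleus :
  middle_nucleus Q = [set ((0, x) : Q) | x in [set: V]].
Proof.
apply/setP => -[b y]; rewrite inE; apply/idP/imsetP => [/forallP H|[z _ [-> ->]]].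
  (* The triple (0, v), (b, y), (1, 0) yields b vA^2 = 0, hence b = 0. *)
  move/(_ ((0, v) : Q))/forallP/(_ ((1, 0) : Q)): H.
  rewrite loopQ_associator !mul0mx mul0r mulr1 scaler0 scaler_eq0 !mulA_eq0.
  by rewrite (negPf v_neq0) orbF => /eqP->; exists y.
apply/forallP => -[a x]; apply/forallP => -[c u].
by rewrite loopQ_associator mul0r mulr0 !scale0r.
Qed.

Lemma loopQ_left_nucleus : left_nucleus Q = [set 1%L].
Proof.
apply/setP => -[a x]; rewrite !inE; apply/forallP/eqP => [H|[-> ->] [b y]].
  (* The pair (1, 0), (0, v) yields a vA^2 = 0; the pair (1, 0), (1, 0) yields xA^2 = 0. *)
  have := H ((1, 0) : Q) => /forallP H1.
  have := H1 ((0, v) : Q); rewrite loopQ_associator !(mulr0, mulr1) scale0r.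
  rewrite eq_sym scaler_eq0 !mulA_eq0 (negPf v_neq0) orbF => /eqP->.
  have := H1 ((1, 0) : Q); rewrite loopQ_associator !mul0mx mulr1 scale1r scaler0.
  by rewrite !mulA_eq0 => /eqP->.
apply/forallP => -[c z].
by rewrite loopQ_associator !mul0mx mul0r scale0r scaler0.
Qed.

Lemma loopQ_right_nucleus : right_nucleus Q = [set 1%L].
Proof.
apply/setP => -[c z]; rewrite !inE; apply/forallP/eqP => [H|[-> ->] [a x]].
  have := H ((0, v) : Q) => /forallP/(_ ((1, 0) : Q)).
  rewrite loopQ_associator mul0r mul1r scale0r scaler_eq0 !mulA_eq0.
  rewrite (negPf v_neq0) orbF => /eqP->.
  have := H ((1, 0) : Q) => /forallP/(_ ((1, 0) : Q)).
  rewrite loopQ_associator !mul0mx mulr1 scale1r scaler0.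
  by rewrite eq_sym !mulA_eq0 => /eqP->.
apply/forallP => -[b y].
by rewrite loopQ_associator !mul0mx mulr0 scale0r scaler0.
Qed.

Lemma loopQ_nucleus : nucleus Q = [set 1%L].
Proof.
rewrite /nucleus loopQ_left_nucleus loopQ_right_nucleus loopQ_middle_nucleus.
by rewrite setIAC setIid; apply/setIidPl; rewrite sub1set; apply/imsetP; exists 0.
Qed.

Lemma loopQ_center : loop_center Q = [set 1%L].
Proof.
rewrite /loop_center loopQ_nucleus; apply/setIidPl; rewrite sub1set inE.
by apply/forallP => -[a x]; rewrite loopQ_commutator mul0mx mul0rn scale0r scaler0.
Qed.

Lemma loopQ_commutant_odd : prime p -> (2 < p)%N -> commutant Q = [set 1%L].
Proof.
move=> p_pr p_gt2; have two_neq0 : 2%:R != 0 :> F.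
  by rewrite -(dvdn_pcharf (pchar_Fp p_pr)) gtnNdvd.
apply/setP => -[a x]; rewrite !inE; apply/forallP/eqP => [H|[-> ->] [b y]].
  (* Commuting with (1, 0) gives 2 xA = 0, and with (0, v) it gives 2a vA = 0. *)
  have := H ((1, 0) : Q); rewrite loopQ_commutator mul0mx scaler0 scaler_eq0.
  rewrite (negPf two_neq0) mulA_eq0 /= => /eqP->.
  have := H ((0, v) : Q); rewrite loopQ_commutator mul0rn scale0r eq_sym.
  rewrite scaler_eq0 mulA_eq0 (negPf v_neq0) orbF -mulr_natr mulf_eq0.
  by rewrite (negPf two_neq0) orbF => /eqP->.
by rewrite loopQ_commutator mul0mx mul0rn scale0r scaler0.
Qed.

End Nuclei.

Lemma loopQ_commutant_even : p = 2 -> commutant Q = [set: Q].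
Proof.
move=> p2; have F2 : 2 \in [pchar F] by rewrite -[X in X \in _]p2 pchar_Fp ?p2.
apply/setP => -[a x]; rewrite !inE; apply/forallP => -[b y].
by rewrite loopQ_commutator !mulrn_pchar // !scale0r.
Qed.

Lemma card_loopQ : prime p -> #|{: Q}| = (p ^ 3)%N.
Proof.
by move=> p_pr; rewrite card_prod card_mx card_Fp // mul1n expnS.
Qed.

End AnisotropicLoop.

Theorem proposition5p6 (p : nat) (p_prime : prime p) (A : 'M['F_p]_2)
    (A_unit : A \in unitmx)
    (direct_IA : directv (<[1%:M : 'M['F_p]_2]> + <[A]>)%VS)
    (plane_IA : anisotropic_plane (<[1%:M : 'M['F_p]_2]> + <[A]>)%VS) :
  [/\ [/\ is_automorphic_loop (loopQ A),
          #|{: loopQ A}| = (p ^ 3)%N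
        & has_exponent (loopQ A) p],
      [/\ middle_nucleus (loopQ A) =
            [set ((0%R, x) : loopQ A) | x in [set: 'rV['F_p]_2]],
          (exists f : 'rV['F_p]_2 -> loopQ A,
             [/\ injective f,
                 f @: [set: 'rV['F_p]_2] = middle_nucleus (loopQ A)
               & forall x y : 'rV['F_p]_2, f (x + y)%R = (f x * f y)%L]),
          left_nucleus (loopQ A) = [set 1%L]
        & right_nucleus (loopQ A) = [set 1%L]],
      [/\ nucleus (loopQ A) = [set 1%L],
          loop_center (loopQ A) = [set 1%L]
        & ~ centrally_nilpotent (loopQ A)]
    & (p = 2 -> commutant (loopQ A) = [set: loopQ A]) /\
      (2 < p -> commutant (loopQ A) = [set 1%L])].
Proof.
have [aniso_IA _] := plane_IA.
have Q_loop : is_loop (loopQ A).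
  by apply: loopQ_is_loop => b; apply: anisotropic_unitmx.
have Z1 := loopQ_center A_unit.
split; last by split=> [|p_gt2]; [apply: loopQ_commutant_even |
                                  apply: loopQ_commutant_odd].
- split; [by split=> //; apply: loopQ_inner_morph | exact: card_loopQ |].
  exact: loopQ_has_exponent.
- rewrite loopQ_middle_nucleus // loopQ_left_nucleus // loopQ_right_nucleus //.
  split=> //; exists (fun x => (0%R, x)); split=> [x y []||x y] //.
  (* On first coordinate 0 the terms in A vanish, leaving vector addition. *)
  by rewrite loopQ_mulE !scale0r addr0 subr0 addr0.
- split=> //; first exact: loopQ_nucleus.
  (* The series stays at [[set 1]], so nilpotency would force p^3 = 1. *)
  case=> n; rewrite upper_central_trivial // => /(congr1 (fun B => #|pred_of_set B|)).
  rewrite cards1 cardsT card_loopQ // => p3.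
  by have := prime_gt1 p_prime; rewrite -(@ltn_exp2r 1 p 3) // exp1n -p3.
Qed.
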